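(* Let $P$ be the $n\times n$ transition matrix of a regular finite homogeneous Markov chain with $n$ states. Let $I$ be the $n \times n$ identity matrix, $J$ the $n\times n$ matrix all of whose entries are $1$, and $e\in\mathbb{R}^n$ the column vector all of whose entries are $1$. For $i=1,\dots,n$, let $P_i$ be the matrix obtained from $P$ by replacing every entry of column $i$ by $0$, and let $A_i=I-P_i$. Suppose the unique solution of the matrix equation $$(I-P)X = J - P X_d$$ in the unknown $n\times n$ real matrix $X$ is $X=(x_1,x_2,\dots,x_n)$, where $x_i$ is the $i$-th column of $X$. Then $$x_i = A_i^{+}e,\qquad i=1,2,\dots,n.$$
   Context: The transition matrix $P=(p_{ij})$ of a finite homogeneous Markov chain $\{X_k\}_{k\ge 0}$ has entries $p_{ij}=\Pr\{X_k=j\mid X_{k-1}=i\}$, so it has nonnegative entries and each of its rows sums to $1$. The chain is regular if some power $P^k$, $k\ge 1$, has all entries strictly positive. For a square matrix $X$, $X_d$ denotes the diagonal matrix formed from the diagonal entries of $X$. For a matrix $A$, $A^{+}$ denotes its Moore-Penrose generalized inverse, i.e. the unique matrix $Y$ satisfying $AYA=A$, $YAY=Y$, $(AY)'=AY$, $(YA)'=YA$, where $'$ denotes conjugate transpose; if $A$ is square and nonsingular, $A^{+}=A^{-1}$. *)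

(* Defs.v *)
From HB Require Import structures.
From mathcomp Require Import all_boot all_order all_algebra.
Set Implicit Arguments.
Unset Strict Implicit.
Unset Printing Implicit Defensive.
Import Order.TTheory GRing.Theory Num.Theory.
Local Open Scope ring_scope.

Definition stochastic (R : numDomainType) (n : nat) (P : 'M[R]_n) : Prop :=
  (forall i j, 0 <= P i j) /\ (forall i, \sum_j P i j = 1).

Definition regular (R : numDomainType) (n : nat) (P : 'M[R]_n) : Prop :=
  exists k : nat, (1 <= k)%N /\ forall i j, 0 < (P ^+ k) i j.

Definition diag_part (R : nmodType) (n : nat) (X : 'M[R]_n) : 'M[R]_n :=
  diag_mx (\row_i X i i).

Definition zero_col (R : nmodType) (m n : nat) (i : 'I_n) (P : 'M[R]_(m, n)) :
    'M[R]_(m, n) :=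
  \matrix_(j, k) (if k == i then 0 else P j k).

(* The scalars are real, so the conjugate transpose is the transpose. *)
Definition penrose (R : realFieldType) (m n : nat)
    (A : 'M[R]_(m, n)) (Y : 'M[R]_(n, m)) : bool :=
  [&& A *m Y *m A == A, Y *m A *m Y == Y,
      (A *m Y)^T == A *m Y & (Y *m A)^T == Y *m A].

Lemma penrose_unique (R : realFieldType) (m n : nat)
    (A : 'M[R]_(m, n)) (Y Z : 'M[R]_(n, m)) :
  penrose A Y -> penrose A Z -> Y = Z.
Proof.
move=> /and4P[/eqP aya /eqP yay /eqP ay /eqP ya].
move=> /and4P[/eqP aza /eqP zaz /eqP az /eqP za].
have eqAY : A *m Y = A *m Z.
  by rewrite -[in LHS]aza -[LHS]mulmxA -[LHS]trmxK trmx_mul ay az !mulmxA aya az.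
have eqYA : Y *m A = Z *m A.
  rewrite -[in LHS]aza -[A *m Z *m A]mulmxA mulmxA.
  by rewrite -[LHS]trmxK trmx_mul ya za -mulmxA (mulmxA A Y) aya za.
by rewrite -yay eqYA -mulmxA eqAY mulmxA zaz.
Qed.

Lemma gram_unitmx (R : realFieldType) (r n : nat) (B : 'M[R]_(r, n)) :
  row_free B -> B *m B^T \in unitmx.
Proof.
move=> freeB; rewrite -row_free_unit; apply/row_freeP.
suff: row_free (B *m B^T) by move/row_freeP.
rewrite -kermx_eq0; apply/eqP/row_matrixP => i; rewrite row0.
set u := row i _.
have uBB : u *m (B *m B^T) = 0.
  by rewrite -row_mul mulmx_ker row0.
have uB : u *m B = 0.
  have: (u *m B) *m (u *m B)^T = 0.
    by rewrite trmx_mul !mulmxA -(mulmxA u) uBB mul0mx.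
  move=> /matrixP /(_ 0 0); rewrite !mxE => /eqP.
  under eq_bigr => j _ do rewrite [X in _ * X]mxE -expr2.
  rewrite psumr_eq0 => [/allP z|j _]; last exact: sqr_ge0.
  apply/rowP => j; rewrite [RHS]mxE; apply/eqP.
  by rewrite -sqrf_eq0; apply: z; rewrite mem_index_enum.
by apply: (row_free_inj freeB); rewrite uB mul0mx.
Qed.

Lemma penrose_exists (R : realFieldType) (m n : nat) (A : 'M[R]_(m, n)) :
  exists Y, penrose A Y.
Proof.
have [r [C [B [defA fullC freeB]]]] : exists r (C : 'M_(m, r)) (B : 'M_(r, n)),
    [/\ A = C *m B, row_full C & row_free B].
  exists (\rank A), (col_base A), (row_base A).
  by rewrite mulmx_base col_base_full row_base_free.
have uB : B *m B^T \in unitmx by exact: gram_unitmx.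
have uC : C^T *m C \in unitmx.
  rewrite -[X in _ *m X]trmxK; apply: gram_unitmx.
  by rewrite /row_free mxrank_tr -/(row_full _).
pose B' := B^T *m invmx (B *m B^T); pose C' := invmx (C^T *m C) *m C^T.
have BB' : B *m B' = 1%:M by rewrite mulmxA mulmxV.
have CC' : C' *m C = 1%:M by rewrite -mulmxA mulVmx.
have AY : A *m (B' *m C') = C *m C'.
  by rewrite defA mulmxA -(mulmxA C) BB' mulmx1.
have YA : (B' *m C') *m A = B' *m B.
  by rewrite defA mulmxA -(mulmxA B') CC' mulmx1.
exists (B' *m C'); apply/and4P; split; apply/eqP.
- by rewrite AY defA mulmxA -(mulmxA C) CC' mulmx1.
- by rewrite YA mulmxA -(mulmxA B') BB' mulmx1.
- by rewrite AY /C' !trmx_mul trmx_inv trmx_mul !trmxK mulmxA.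
- by rewrite YA /B' !trmx_mul trmx_inv trmx_mul !trmxK mulmxA.
Qed.

(* Well defined by penrose_unique. It is not the library's pinvmx, which need not
   satisfy the two symmetry equations. *)
Definition mpinv (R : realFieldType) (m n : nat) (A : 'M[R]_(m, n)) :
    'M[R]_(n, m) :=
  xchoose (penrose_exists A).

Lemma mpinvP (R : realFieldType) (m n : nat) (A : 'M[R]_(m, n)) :
  penrose A (mpinv A).
Proof. exact: xchooseP. Qed.

Lemma mpinv_unitmx (R : realFieldType) (n : nat) (A : 'M[R]_n) :
  A \in unitmx -> mpinv A = invmx A.
Proof.
move=> uA; apply: penrose_unique (mpinvP A) _; apply/and4P.
by split; rewrite ?mulmxV ?mulVmx ?mul1mx ?trmx1.
Qed.

(* Main.v *)
Require Import Defs.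
From mathcomp Require Import all_boot all_order all_algebra.
From mathcomp Require Import reals.
Import Order.TTheory GRing.Theory Num.Theory.
Local Open Scope ring_scope.

(** The matrix equation decouples into one linear system per column.  In column
    [i], the term [P X_d] contributes the [i]-th column of [P] scaled by [X i i],
    which is exactly the part of [P x_i] that is lost when [P] is replaced by
    [P_i]; moving it to the left-hand side turns the equation into
    [A_i x_i = e] ([matrix_eq_colP]).

    Since the systems are independent, column [i] of a solution can be shifted by
    any vector of the kernel of [A_i] without spoiling the other columns.
    Uniqueness of the solution therefore forces every [A_i] to have a trivial
    kernel, so [A_i] is invertible, its Moore-Penrose inverse is its inverse, and
    [x_i = A_i^-1 e]. *)

Lemma unitmx_ker0 (F : fieldType) (n : nat) (A : 'M[F]_n) :
  (forall v : 'cV_n, A *m v = 0 -> v = 0) -> A \in unitmx.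
Proof.
move=> kerA; rewrite -unitmx_tr -row_free_unit -kermx_eq0.
apply/eqP/row_matrixP => k; rewrite row0; apply: trmx_inj; rewrite trmx0.
by apply: kerA; apply: trmx_inj; rewrite trmx_mul trmxK -row_mul mulmx_ker row0 trmx0.
Qed.

Lemma zero_col_mul_col (R : pzRingType) (n : nat) (P Y : 'M[R]_n) (i : 'I_n) :
  zero_col i P *m col i Y = col i (P *m Y) - col i (P *m diag_part Y).
Proof.
apply/colP => j; rewrite /diag_part mul_mx_diag !mxE (bigD1 i) //=.
rewrite [in RHS](bigD1 i) //= !mxE eqxx mul0r add0r addrC addKr.
by apply: eq_bigr => k /negPf nki; rewrite !mxE nki.
Qed.

(** The equation decouples because the [i]-th column of [P Y - P Y_d] is
    [P_i y_i], which involves no other column of [Y]. *)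
Lemma matrix_eq_colP (R : pzRingType) (n : nat) (P Y : 'M[R]_n) :
  (1%:M - P) *m Y = const_mx 1 - P *m diag_part Y <->
  forall i, (1%:M - zero_col i P) *m col i Y = const_mx 1.
Proof.
have colE i : (1%:M - zero_col i P) *m col i Y =
    col i ((1%:M - P) *m Y + P *m diag_part Y).
  rewrite [LHS]mulmxBl mul1mx zero_col_mul_col opprB addrA addrAC.
  by rewrite mulmxBl mul1mx raddfD raddfB.
split=> [eqY i | eqY].
  by rewrite colE eqY subrK; apply/colP => j; rewrite !mxE.
apply/eqP; rewrite eq_sym subr_eq eq_sym; apply/eqP/matrixP => j i.
by have /colP/(_ j) := eqY i; rewrite colE !mxE.
Qed.

(** A kernel vector of [A_i] added to column [i] gives a second solution. *)
Lemma unique_solution_unitmx (F : fieldType) (n : nat) (P X : 'M[F]_n) :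
  unique (fun Y : 'M[F]_n =>
            (1%:M - P) *m Y = const_mx 1 - P *m diag_part Y) X ->
  forall i, 1%:M - zero_col i P \in unitmx.
Proof.
move=> [/matrix_eq_colP eqX uniqX] i; apply: unitmx_ker0 => v Av0.
pose V : 'M[F]_n := v *m delta_mx 0 i.
have colV k : col k V = if k == i then v else 0.
  apply/colP => j; rewrite !mxE big_ord1 !mxE eqxx /=.
  by case: eqP => _; rewrite ?mulr1 // mulr0 mxE.
have eqXV : X = X + V.
  apply: uniqX; apply/matrix_eq_colP => k.
  rewrite raddfD /= mulmxDr eqX colV.
  by case: eqP => [->|_]; rewrite ?Av0 ?mulmx0 addr0.
have V0 : V = 0 by apply: (addrI X); rewrite addr0 -eqXV.
by have := colV i; rewrite eqxx V0 col0.
Qed.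

Theorem theorem2 (R : realType) (n : nat) (P X : 'M[R]_n)
    (hP : stochastic P) (hreg : regular P)
    (hX : unique (fun Y : 'M[R]_n =>
                    (1%:M - P) *m Y = const_mx 1 - P *m diag_part Y) X)
    (i : 'I_n) :
  col i X = mpinv (1%:M - zero_col i P) *m (const_mx 1 : 'cV[R]_n).
Proof.
have uA := unique_solution_unitmx _ _ _ _ hX i.
by rewrite (mpinv_unitmx uA) -((matrix_eq_colP _ _ _ _).1 hX.1 i) mulKmx.
Qed.
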